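(* Let $m,n,r\geq1$ be integers with $\gcd(m,n)=1$. Then the number of rank $r$ semistandard $\frac mn$-parking functions is the rank $r$ rational $\frac mn$-Catalan number: $$|\mathcal{PF}^r_{\frac mn}|=C_{\frac mn,r},\qquad C_{\frac mn,r}=\frac1n\binom{nr+m-1}{m}.$$
   Context: An $\frac mn$-Dyck path is a lattice path in $\mathbb{Z}^2$ from $(0,0)$ to $(n,m)$ using only steps $(1,0)$ and $(0,1)$ that always stays (weakly) above the diagonal line $y=\frac mn x$; the set of these is $\mathcal D_{\frac mn}$. A vertical run of a Dyck path is a maximal collection of consecutive vertical steps. A rank $r$ semistandard $\frac mn$-parking function is a pair $(D,\varphi)$ where $D\in\mathcal D_{\frac mn}$ and $\varphi$ is a function from the set of vertical steps of $D$ to $\{1,\dots,r\}$ that is weakly increasing along each vertical run, reading from top to bottom. $\mathcal{PF}^r_{\frac mn}$ is the set of these. The paper defines the rank $r$ rational $\frac mn$-Catalan number as $C_{\frac mn,r}:=\dim\overline{L}_{\frac mn,r}=\frac1n\binom{nr+m-1}{m}$, where $\overline L_{\frac mn,r}$ is the unique simple finite-dimensional module over the algebra $(D(\overline R)/D(\overline R)\{\xi_{\overline R}-\frac mn\mathrm{tr}\,\xi\mid\xi\in\mathfrak{gl}_n\})^{\mathrm{GL}_n}$, with $\overline R=\mathfrak{sl}_n\oplus\mathrm{Hom}(\mathbb{C}^n,\mathbb{C}^r)$, $D(\overline R)$ the polynomial differential operators, and $\xi_{\overline R}$ the vector field giving the infinitesimal action of $\xi$ on $\mathbb{C}[\overline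 R]$; the dimension is given by the displayed binomial formula. *)

(* Defs.v *)
From mathcomp Require Import all_boot all_order all_algebra.

Set Implicit Arguments.
Unset Strict Implicit.
Unset Printing Implicit Defensive.

Import GRing.Theory Num.Theory.

(* A lattice path from (0,0) is the word of its steps: [true] is the vertical  *)
(* step (0,1) and [false] is the horizontal step (1,0). The path from (0,0)    *)
(* to (n,m) has n + m steps.                                                   *)
Definition abscissa (w : seq bool) (k : nat) : nat := count_mem false (take k w).
Definition ordinate (w : seq bool) (k : nat) : nat := count_mem true (take k w).

(* "Weakly above y = (m/n) x" is stated without division, n being positive.    *)
(* Testing the lattice points of the path is enough: the half-plane is convex. *)
Definition is_dyck (m n : nat) (w : (n + m).-tuple bool) : bool :=
  [&& abscissa w (n + m) == n,
      ordinate w (n + m) == m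
    & [forall k : 'I_(n + m).+1, m * abscissa w k <= n * ordinate w k]].

Definition dyck_path (m n : nat) : finType :=
  {w : (n + m).-tuple bool | is_dyck w}.

Definition vertical_step (m n : nat) (D : dyck_path m n) : finType :=
  {i : 'I_(n + m) | tnth (val D) i}.

(* The steps are ordered by their position [val i] along the path, that is,    *)
(* from bottom to top within a run.                                            *)
Definition consecutive (m n : nat) (D : dyck_path m n)
    (A : {set vertical_step D}) : bool :=
  [forall i in A, forall j in A, forall k : 'I_(n + m),
    (val i <= k <= val j) ==> [exists l in A, val l == k]].

Definition vertical_run (m n : nat) (D : dyck_path m n)
    (A : {set vertical_step D}) : bool :=
  maxset (@consecutive m n D) A.

(* The labels {1, ..., r} are represented by {0, ..., r-1}; only their order   *)
(* matters.                                                                    *)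
Definition semistandard (m n r : nat) (D : dyck_path m n)
    (phi : {ffun vertical_step D -> 'I_r}) : bool :=
  [forall A : {set vertical_step D}, vertical_run A ==>
    [forall i in A, forall j in A, (val i <= val j) ==> (phi j <= phi i)]].

Definition labelled_dyck_path (m n r : nat) : finType :=
  {D : dyck_path m n & {ffun vertical_step D -> 'I_r}}.

Definition parking_functions (m n r : nat) : {set labelled_dyck_path m n r} :=
  [set p | semistandard (tagged p)].

Local Open Scope ring_scope.

(* The closed form of the dimension of the simple module that the rational     *)
(* Catalan number measures; taken in [rat], so that 1/n is an exact division.  *)
Definition rational_catalan (m n r : nat) : rat :=
  n%:R^-1 * 'C(n * r + m - 1, m)%:R.

(* Main.v *)
Require Import Defs.
From mathcomp Require Import all_boot all_order all_algebra.
From mathcomp Require Import zify.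

(** The labels of a vertical run are weakly monotone, so a run is determined by
    the multiset of its labels, and a semistandard parking function by the [n]
    multisets of labels carried by the runs at the abscissae 0, ..., n-1. Giving
    the vertical step at abscissa [x] with label [c] the key
    [x * r + (r - 1 - c)], such data become a multiset of [m] keys in
    {0, ..., nr-1}, that is, [m] balls in [n] rows of [r] cells; the keys are
    read in increasing order along the path ([keys_inj], [keys_surj],
    [sorted_keys], [semistandard_word]). There are 'C(nr + m - 1, m) such
    multisets in all ([size_multisets]), and those that come from parking
    functions are the ones whose row sums describe a path weakly above the
    diagonal ([above_keys], [card_parking_functions]).

    The factor 1/n is the cycle lemma. The cyclic group of order [n] acts on the
    multisets by permuting the rows cyclically. Shifting the row [j] to the front
    gives a path above the diagonal iff the excess of the path over the diagonal
    is minimal at abscissa [j] ([above_shift]). As [m] and [n] are coprime, the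
    excess takes distinct values at 0, ..., n-1 ([excess_inj]), so exactly one of
    the [n] shifts qualifies ([cycle_lemma]), and the multisets above the diagonal
    are one [n]-th of all ([count_above]). *)

Set Implicit Arguments.
Unset Strict Implicit.
Unset Printing Implicit Defensive.

(** * Labelled paths as words, words as sequences of keys *)

(** The label is reversed because labels decrease weakly from bottom to top along
    a run, while keys are to increase along the path. *)
Definition key r x (c : 'I_r) : nat := x * r + rev_ord c.

(** [None] is a horizontal step, [Some c] a vertical step labelled [c], and [x] is
    the abscissa at which the word [u] starts. *)
Fixpoint keys r x (u : seq (option 'I_r)) : seq nat :=
  match u with
  | [::] => [::]
  | None :: v => keys x.+1 v
  | Some c :: v => key x c :: keys x v
  end.

Definition run_step r (a b : option 'I_r) : bool :=
  match a, b with Some c, Some d => d <= c | _, _ => true end.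

Lemma key_bounds r x (c : 'I_r) : x * r <= key x c < x.+1 * r.
Proof. by rewrite /key leq_addr mulSn addnC ltn_add2r ltn_ord. Qed.

Lemma leq_key r x (c d : 'I_r) : (key x c <= key x d) = (d <= c).
Proof. by rewrite /key leq_add2l /= leq_sub2lE. Qed.

Lemma key_inj r x : injective (@key r x).
Proof.
by move=> c d /addnI eq_cd; apply: (can_inj rev_ordK); apply: val_inj.
Qed.

Lemma key_onto r k : 0 < r -> exists c : 'I_r, key (k %/ r) c = k.
Proof.
move=> r_gt0; exists (rev_ord (Ordinal (ltn_pmod k r_gt0))).
by rewrite /key rev_ordK /= -divn_eq.
Qed.

Lemma keys_ge r x (u : seq (option 'I_r)) : all (leq (x * r)) (keys x u).
Proof.
elim: u x => [|[c|] u IHu] x //=.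
  by rewrite IHu andbT; case/andP: (key_bounds x c).
by apply: sub_all (IHu x.+1) => k; apply: leq_trans; rewrite leq_mul2r leqnSn orbT.
Qed.

Lemma size_keys r x (u : seq (option 'I_r)) : size (keys x u) = count isSome u.
Proof. by elim: u x => [|[c|] u IHu] x //=; rewrite IHu. Qed.

Lemma keys_nseq_None r x j : keys x (nseq j (@None 'I_r)) = [::].
Proof. by elim: j x => //= j IHj x. Qed.

Lemma keys_cat r x (u v : seq (option 'I_r)) :
  keys x (u ++ v) = keys x u ++ keys (x + count_mem None u) v.
Proof.
elim: u x => [|[c|] u IHu] x /=; rewrite ?addn0 ?add0n ?IHu //.
by rewrite addSnnS.
Qed.

(** Equal numbers of horizontal steps are needed because those that follow the
    last vertical step leave no trace in the keys. If one word starts with a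
    horizontal step and the other with a vertical one, the keys differ at once:
    all the keys of the former lie in later rows. *)
Lemma keys_inj r x (u v : seq (option 'I_r)) :
  count_mem None u = count_mem None v -> keys x u = keys x v -> u = v.
Proof.
have absurd y c w s : @keys r y.+1 w <> @key r y c :: s.
  move=> eq_w; have := keys_ge y.+1 w.
  rewrite eq_w => /andP[+ _]; rewrite leqNgt.
  by case/andP: (key_bounds y c) => _ ->.
elim: u v x => [|[c|] u IHu] [|[d|] v] x //=.
- by rewrite !add0n => eq_uv [/key_inj -> /IHu ->].
- by move=> _ /esym/absurd.
- by move=> _ /absurd.
- by rewrite !add1n => -[eq_uv] /IHu ->.
Qed.

(** The word is read off greedily: before the step of key [k], walk horizontally
    until the abscissa is [k %/ r]. *)
Lemma keys_surj r x n s : 0 < r -> sorted leq s ->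
    all (fun k => x * r <= k < (x + n) * r) s ->
  exists2 u : seq (option 'I_r), count_mem None u = n & keys x u = s.
Proof.
move=> r_gt0; elim: s x n => [|k s IHs] x n.
  exists (nseq n None); first by rewrite count_nseq mul1n.
  by rewrite keys_nseq_None.
rewrite /= (path_sortedE leq_trans) => /andP[ks s_sorted] /andP[/andP[xk kn] s_in].
have [c key_c] := key_onto k r_gt0; set y := k %/ r in key_c.
have le_xy : x <= y by rewrite leq_divRL.
have lt_y : y < x + n by rewrite ltn_divLR.
have [||u count_u keys_u] := IHs y (n - (y - x)) => //.
  apply/allP=> l l_s; have := allP ks l l_s; have /andP[_] := allP s_in l l_s.
  have -> : y + (n - (y - x)) = x + n by lia.
  by move=> -> /=; rewrite andbT; apply: leq_trans; rewrite leq_divM.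
exists (nseq (y - x) None ++ Some c :: u).
  by rewrite count_cat count_nseq /= count_u; lia.
rewrite keys_cat count_nseq mul1n subnKC //= key_c keys_u.
by rewrite keys_nseq_None.
Qed.

(** A horizontal step raises every later key above all the earlier ones, so the
    only comparisons of keys that can fail are between adjacent vertical steps. *)
Lemma sorted_keys r x (u : seq (option 'I_r)) :
  sorted leq (keys x u) = sorted (@run_step r) u.
Proof.
have -> : sorted (@run_step r) u = path (@run_step r) None u by case: u.
suff: forall y, sorted leq (keys y u) = path (@run_step r) None u /\
       forall c, path leq (@key r y c) (keys y u) = path (@run_step r) (Some c) u.
  by case/(_ x).
elim: u => [|[d|] u IHu] y //=.
  by case: (IHu y) => _ IH; split=> [|c]; rewrite IH ?leq_key.
have [IH _] := IHu y.+1; split=> // c; rewrite -IH path_min_sorted //.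
apply: sub_all (keys_ge y.+1 u) => k; apply: leq_trans.
by apply: ltnW; case/andP: (key_bounds y c).
Qed.

(** * The diagonal condition in terms of keys *)

(** The keys below [x * r] belong to the vertical steps of abscissa less than [x],
    so their number is the ordinate at which the path reaches the line of
    abscissa [x]. *)
Definition above m n r (s : seq nat) : bool :=
  [forall x : 'I_n.+1, m * x <= n * count (fun k => k < x * r) s].

(** The prefix meant here stops as soon as the path reaches the abscissa [x],
    where it is at its lowest point on that vertical line. *)
Lemma take_row r x y (u : seq (option 'I_r)) : x <= count_mem None u ->
  exists k, [/\ k <= size u, count_mem None (take k u) = x
              & all (fun k => k < (y + x) * r) (keys y (take k u))].
Proof.
case: (posnP x) => [->|x_gt0]; first by exists 0; rewrite take0.
elim: u x y x_gt0 => [|[c|] u IHu] [|x] y //= _.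
  rewrite add0n => /(IHu x.+1 y isT)[k [le_k cnt_k all_k]].
  exists k.+1; split=> //=; rewrite all_k andbT.
  have /andP[_] := key_bounds y c; move/leq_trans; apply.
  by rewrite leq_mul2r addnS ltnS leq_addr orbT.
rewrite add1n ltnS; case: (posnP x) => [-> _|x_gt0 le_x].
  by exists 1; rewrite /= take0.
have [k [le_k cnt_k all_k]] := IHu x y.+1 x_gt0 le_x.
by exists k.+1; split; rewrite //= ?cnt_k // addnS -addSn.
Qed.

(** On each vertical line the lowest point of the path is the critical one, and
    the ordinate of that point is the count in [above]. *)
Lemma above_keys m n r (u : seq (option 'I_r)) :
    count_mem None u = n -> count isSome u = m ->
  (forall k, k <= size u ->
     m * count_mem None (take k u) <= n * count isSome (take k u))
  <-> above m n r (keys 0 u).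
Proof.
move=> cnt_u size_u; split=> [dyck|/forallP abv k le_k].
  apply/forallP=> x; have: x <= count_mem None u by rewrite cnt_u -ltnS.
  case/(take_row 0) => k [le_k cnt_k all_k].
  rewrite -[X in m * X]cnt_k; apply: leq_trans (dyck k le_k) _.
  rewrite leq_mul2l -[in keys 0 u](cat_take_drop k u) keys_cat count_cat.
  by move: all_k; rewrite all_count size_keys add0n => /eqP->; rewrite leq_addr orbT.
have lt_x : count_mem None (take k u) < n.+1.
  by rewrite ltnS -cnt_u -{2}(cat_take_drop k u) count_cat leq_addr.
apply: leq_trans (abv (Ordinal lt_x)) _ => /=.
rewrite leq_mul2l -[in keys 0 u](cat_take_drop k u) keys_cat count_cat.
rewrite -(size_keys 0) add0n [X in _ + X](_ : _ = 0).
  by rewrite addn0 count_size orbT.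
apply/eqP; rewrite -leqn0 leqNgt -has_count -all_predC.
by apply: sub_all (keys_ge _ _) => l /=; rewrite -leqNgt.
Qed.

(** * Parking functions as words *)

Definition word m n r (p : labelled_dyck_path m n r) : seq (option 'I_r) :=
  [seq omap (tagged p) (insub i) | i <- enum 'I_(n + m)].

Lemma size_word m n r (p : labelled_dyck_path m n r) : size (word p) = n + m.
Proof. by rewrite size_map size_enum_ord. Qed.

Lemma nth_word m n r (p : labelled_dyck_path m n r) d (i : 'I_(n + m)) :
  nth d (word p) i = omap (tagged p) (insub i).
Proof.
by rewrite (nth_map i) ?size_enum_ord // nth_ord_enum.
Qed.

Lemma nth_word_vertical m n r (p : labelled_dyck_path m n r) d
  (i : vertical_step (tag p)) : nth d (word p) (val i) = Some (tagged p i).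
Proof. by rewrite nth_word valK. Qed.

Lemma map_word m n r (p : labelled_dyck_path m n r) :
  map isSome (word p) = val (tag p).
Proof.
rewrite -map_comp -[RHS]map_tnth_enum; apply: eq_map => i /=.
by case: insubP => [v -> //|/negPf ->].
Qed.

Lemma count_isSome_word m n r (p : labelled_dyck_path m n r) k :
  count isSome (take k (word p)) = ordinate (val (tag p)) k.
Proof.
rewrite /ordinate -map_word -map_take count_map; apply: eq_count => -[c|] //.
Qed.

Lemma count_None_word m n r (p : labelled_dyck_path m n r) k :
  count_mem None (take k (word p)) = abscissa (val (tag p)) k.
Proof.
rewrite /abscissa -map_word -map_take count_map; apply: eq_count => -[c|] //.
Qed.

Lemma word_inj m n r : injective (@word m n r).
Proof.
move=> [D f] [E g] eq_w.
have eqDE : D = E.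
  do 2!apply: val_inj.
  have := map_word (existT _ D f : labelled_dyck_path m n r).
  by rewrite eq_w map_word.
case: E / eqDE g eq_w => g eq_w; congr (existT _ _ _); apply/ffunP => i.
apply: Some_inj; have := @nth_word_vertical m n r (existT _ D f) None i.
by rewrite eq_w; have /= -> := @nth_word_vertical m n r (existT _ D g) None i.
Qed.

Lemma word_surj m n r (u : seq (option 'I_r)) : 0 < r ->
    count_mem None u = n -> count isSome u = m -> above m n r (keys 0 u) ->
  exists p : labelled_dyck_path m n r, word p = u.
Proof.
move=> r_gt0 cnt_u size_u abv.
have sz_u : size u = n + m.
  rewrite -cnt_u -size_u -(count_predC (pred1 None)); congr (_ + _).
  by apply: eq_count => -[].
have sz_w : size (map isSome u) == n + m by rewrite size_map sz_u.
have abs_w k : abscissa (map isSome u) k = count_mem None (take k u).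
  by rewrite /abscissa -map_take count_map; apply: eq_count => -[].
have ord_w k : ordinate (map isSome u) k = count isSome (take k u).
  by rewrite /ordinate -map_take count_map; apply: eq_count => -[].
have dyck_w : is_dyck (Tuple sz_w).
  rewrite /is_dyck /= !abs_w !ord_w -sz_u take_size cnt_u size_u !eqxx /=.
  apply/forallP=> k; rewrite abs_w ord_w.
  by case: (above_keys cnt_u size_u) => _; apply; rewrite // -ltnS.
pose D : dyck_path m n := Sub (Tuple sz_w) dyck_w.
pose f : {ffun vertical_step D -> 'I_r} :=
  [ffun i : vertical_step D => odflt (Ordinal r_gt0) (nth None u (val i))].
exists (existT _ D f).
apply: (@eq_from_nth _ None); rewrite size_word ?sz_u // => i lt_i.
rewrite -[i]/(val (Ordinal lt_i)) nth_word /=.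
case: insubP => [v|] /=; rewrite (tnth_nth false) /= (nth_map None) ?sz_u //.
  by move=> + eq_v; rewrite ffunE [\val v]eq_v /=; case: (nth _ u i).
by case: (nth _ u i).
Qed.

(** Two adjacent vertical steps form a consecutive set, which lies in some maximal
    one, so semistandardness compares their labels. Conversely two steps of a run
    are joined by vertical steps of the same run, and the adjacent comparisons
    compose. *)
Lemma semistandard_word m n r (p : labelled_dyck_path m n r) :
  semistandard (tagged p) = sorted (@run_step r) (word p).
Proof.
apply/forallP/(sortedP None) => [ss k|adj A].
  rewrite size_word => lt_k; have lt_k' := ltnW lt_k.
  have [v v_k|novert] := insubP (vertical_step (tag p)) (Ordinal lt_k'); last first.
    by rewrite -[k]/(val (Ordinal lt_k')) nth_word insubN.
  have [w w_k|novert] := insubP (vertical_step (tag p)) (Ordinal lt_k); last first.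
    rewrite -[k.+1]/(val (Ordinal lt_k)) [X in run_step _ X]nth_word insubN //.
    by case: nth.
  move=> eq_w eq_v; have val_v : val (val v) = k by rewrite eq_v.
  have val_w : val (val w) = k.+1 by rewrite eq_w.
  have cons_vw : consecutive [set v; w].
    apply/forall_inP=> i i_in; apply/forall_inP=> j j_in; apply/forallP=> l.
    apply/implyP=> /andP[le_il le_lj].
    have: (val l == k) || (val l == k.+1).
      by move: i_in j_in le_il le_lj; rewrite !inE => /orP[] /eqP-> /orP[] /eqP->;
         rewrite /= ?val_v ?val_w; lia.
    case/orP=> /eqP l_k; apply/exists_inP; [exists v | exists w];
      by rewrite ?inE ?eqxx ?orbT //; apply/eqP/val_inj; rewrite l_k.
  have [A runA /subsetP sub_vw] := maxset_exists cons_vw.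
  have vA : v \in A by rewrite sub_vw // set21.
  have wA : w \in A by rewrite sub_vw // set22.
  have /implyP/(_ runA)/forall_inP/(_ v vA)/forall_inP/(_ w wA)/implyP := ss A.
  rewrite -[X in _ -> run_step _ (nth _ _ X)]val_w -[in X in _ -> X]val_v.
  rewrite !nth_word_vertical; apply.
  by rewrite val_v val_w.
apply/implyP=> /maxsetp consA; apply/forall_inP=> i iA; apply/forall_inP=> j jA.
apply/implyP; have [d] := ubnP (val j - val i).
elim: d j jA => // d IHd j jA lt_d; rewrite leq_eqVlt => /orP[/eqP eq_ij|lt_ij].
  by rewrite (_ : i = j) //; do 2!apply: val_inj.
have j_gt0 : 0 < (val j : nat) by apply: leq_ltn_trans lt_ij.
have lt_l : (val j : nat).-1 < n + m by rewrite (leq_ltn_trans (leq_pred _)) ?ltn_ord.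
have /forall_inP/(_ i iA)/forall_inP/(_ j jA)/forallP/(_ (Ordinal lt_l))/implyP := consA.
case/(_ _)/exists_inP; first by rewrite /= leq_pred andbT -ltnS prednK.
move=> l lA /eqP eq_l; have val_l : (val l : nat) = (val j : nat).-1 by rewrite eq_l.
have val_j : (val j : nat) = (val l : nat).+1 by rewrite val_l prednK.
apply: (@leq_trans (tagged p l)); last first.
  apply: IHd => //; last by rewrite val_l -ltnS prednK.
  by rewrite -ltnS (leq_trans _ lt_d) // ltnS ltn_sub2r // val_l ltn_predL.
have := adj (val l : nat); rewrite size_word -val_j.
by rewrite !nth_word_vertical; apply; rewrite ltn_ord.
Qed.

(** * Multisets of cells and their cyclic shifts *)

(** A multiset of size [m] of cells in ['I_N], represented by its sorted list. *)
Definition multisets N m : seq (seq nat) :=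
  [seq map val (val t) | t <- enum [set t : m.-tuple 'I_N | sorted leq (map val t)]].

Lemma multisets_uniq N m : uniq (multisets N m).
Proof.
by rewrite map_inj_uniq ?enum_uniq // => s t /(inj_map val_inj)/val_inj.
Qed.

Lemma mem_multisets N m s :
  (s \in multisets N m) = [&& sorted leq s, size s == m & all (fun k => k < N) s].
Proof.
apply/mapP/and3P => [[t] | [s_sorted s_size s_lt]].
  rewrite mem_enum inE => t_sorted ->; split=> //; first by rewrite size_map size_tuple.
  by apply/allP=> k /mapP[i _ ->]; apply: ltn_ord.
have s_val : map val (pmap insub s : seq 'I_N) = s.
  rewrite (pmap_filter (insubK _)); apply/all_filterP.
  by apply: sub_all s_lt => k lt_k; rewrite isSome_insub.
have t_size : size (pmap insub s : seq 'I_N) == m by rewrite -(size_map val) s_val.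
by exists (Tuple t_size); rewrite ?mem_enum ?inE /= s_val.
Qed.

Lemma size_multisets N m : 0 < N -> size (multisets N m) = 'C(N + m - 1, m).
Proof.
case: N => // N _; rewrite size_map -cardE card_sorted_tuples.
by rewrite addSn subn1 addnC.
Qed.

(** Translation of a multiset in the cyclic group of order [N]. *)
Definition shift N d (s : seq nat) : seq nat :=
  sort leq [seq (k + d) %% N | k <- s].

Lemma shift_shift N d e s : shift N e (shift N d s) = shift N (d + e) s.
Proof.
apply/(perm_sortP leq_total leq_trans anti_leq).
rewrite (perm_trans (perm_map _ (permEl (perm_sort _ _)))) // -map_comp.
by rewrite (eq_map (g := fun k => (k + (d + e)) %% N)) // => k /=; rewrite modnDml addnA.
Qed.

Lemma shift_period N m s : s \in multisets N m -> shift N N s = s.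
Proof.
rewrite mem_multisets => /and3P[s_sorted _ /allP s_lt]; rewrite /shift map_id_in.
  exact: sorted_sort leq_trans _ s_sorted.
by move=> k /s_lt lt_k; rewrite modnDr modn_small.
Qed.

Lemma shift_multisets N m d s : 0 < N ->
  s \in multisets N m -> shift N d s \in multisets N m.
Proof.
move=> N_gt0; rewrite !mem_multisets (sort_sorted leq_total) size_sort size_map.
by case/and3P=> _ -> _; rewrite all_sort all_map; apply/allP=> k _ /=; rewrite ltn_pmod.
Qed.

(** Translation by [d] permutes the multisets, the inverse being translation by
    [N - d]. *)
Lemma count_shift N m d (P : pred (seq nat)) : 0 < N -> d <= N ->
  count (fun s => P (shift N d s)) (multisets N m) = count P (multisets N m).
Proof.
move=> N_gt0 le_d; rewrite -[LHS](count_map (shift N d) P); apply/permP.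
have shiftK e : e <= N ->
    {in multisets N m, cancel (shift N e) (shift N (N - e))}.
  by move=> le_e s s_in; rewrite shift_shift subnKC // (shift_period s_in).
apply: uniq_perm; rewrite ?multisets_uniq //.
  by rewrite map_inj_in_uniq ?multisets_uniq //; apply: can_in_inj (shiftK d le_d).
move=> s; apply/mapP/idP => [[t t_in ->]|s_in]; first exact: shift_multisets.
exists (shift N (N - d) s); first exact: shift_multisets.
by have := shiftK (N - d) (leq_subr _ _) s s_in; rewrite subKn.
Qed.

Definition before r (s : seq nat) x : nat := count (fun k => k < x * r) s.

(** Shifting by [n - j] rows brings row [j] to the top, so the first [x] rows of
    the new multiset are the rows from [j] to [x + j - 1] of the old one, taken
    cyclically. The count of the first [j] rows stands on the left to avoid
    truncated subtractions. *)
Lemma before_shift n r s x j : x <= n -> j <= n -> all (fun k => k < n * r) s ->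
  before r (shift (n * r) ((n - j) * r) s) x + before r s j =
    if x + j <= n then before r s (x + j) else size s + before r s (x + j - n).
Proof.
move=> le_x le_j; rewrite /before count_sort count_map.
elim: s => [|k s IHs] /=; first by rewrite !if_same.
case/andP=> lt_k /IHs {IHs}; set a := count _ s; move: a => a IHs.
set b := (k + _) %% _ < _.
suff: b + (k < j * r) =
    if x + j <= n then (k < (x + j) * r) : nat else 1 + (k < (x + j - n) * r).
  by case: ifP IHs => _; lia.
have le_xr : x * r <= n * r by rewrite leq_mul2r le_x orbT.
have le_jr : j * r <= n * r by rewrite leq_mul2r le_j orbT.
have [lt_kj|le_jk] := ltnP k (j * r); rewrite {}/b mulnBl.
  rewrite modn_small; last by lia.
  case: (leqP (x + j) n) => le_xj; rewrite ?mulnBl mulnDl.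
    have : (x + j) * r <= n * r by rewrite leq_mul2r le_xj orbT.
    by rewrite mulnDl; lia.
  have : n * r <= (x + j) * r by rewrite leq_mul2r ltnW ?orbT.
  by rewrite mulnDl; lia.
have -> : k + (n * r - j * r) = n * r + (k - j * r) by lia.
rewrite modnDl modn_small; last by lia.
case: (leqP (x + j) n) => le_xj; rewrite ?mulnBl mulnDl; first by lia.
have : n * r <= (x + j) * r by rewrite leq_mul2r ltnW ?orbT.
by rewrite mulnDl; lia.
Qed.

(** This is the vertical excess of the path over the diagonal on the line of
    abscissa [x], scaled by [n] and translated by [m * n] so that it is a natural
    number. *)
Definition excess m n r s x : nat := n * before r s x + m * (n - x).

Lemma before_full n r s : all (fun k => k < n * r) s -> before r s n = size s.
Proof. by rewrite all_count => /eqP. Qed.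

Lemma before0 r s : before r s 0 = 0.
Proof. by rewrite /before mul0n -[RHS](count_pred0 s); apply: eq_count. Qed.

(** Starting the path afresh at column [j] turns its excess at [y] into the
    difference of the excesses at [y] and [j]; the new path stays above the
    diagonal iff none of these is negative. *)
Lemma above_shift m n r s j : j < n -> s \in multisets (n * r) m ->
  above m n r (shift (n * r) ((n - j) * r) s) =
  [forall y : 'I_n, excess m n r s j <= excess m n r s y].
Proof.
move=> lt_j; rewrite mem_multisets => /and3P[_ /eqP s_size s_lt].
have le_j := ltnW lt_j.
have beforeS x (le_x : x <= n) := before_shift le_x le_j s_lt.
(* The excess is the same at the abscissae 0 and n, so it may be read modulo n. *)
have above_row x : x <= n -> (m * x <= n * before r (shift (n * r) ((n - j) * r) s) x) =
    (excess m n r s j <= excess m n r s (if x + j < n then x + j else x + j - n)).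
  move=> le_x; have := congr1 (muln n) (beforeS x le_x).
  rewrite mulnDr /excess !mulnBr; case: (ltngtP (x + j) n) => cmp eq_row.
  - have : m * (x + j) <= m * n by rewrite leq_mul2l (ltnW cmp) orbT.
    by rewrite !mulnDr; lia.
  - have : m * n <= m * (x + j) by rewrite leq_mul2l (ltnW cmp) orbT.
    have : m * (x + j - n) <= m * n by apply: leq_mul => //; lia.
    move: eq_row; rewrite mulnDr s_size mulnBr mulnDr [n * m]mulnC.
    have : m * j <= m * n by rewrite leq_mul2l le_j orbT.
    by lia.
  - move: eq_row; rewrite cmp subnn before0 (before_full s_lt) s_size !muln0 subn0.
    have <- : m * (x + j) = m * n by rewrite cmp.
    have -> : n * m = m * (x + j) by rewrite cmp mulnC.
    by rewrite mulnDr; lia.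
apply/forallP/forallP => [abv y|min x].
  pose x := if j <= y then y - j else y + n - j.
  have lt_y : y < n := ltn_ord y.
  have lt_x : x < n.+1 by rewrite /x; case: (leqP j y) => cmp; lia.
  have abv_x : m * x <= n * before r _ x := abv (Ordinal lt_x).
  have y_x : (if x + j < n then x + j else x + j - n) = y.
    by rewrite /x; case: (leqP j y) => cmp; case: ifP; lia.
  by rewrite above_row // y_x in abv_x.
have le_x : x <= n by rewrite -ltnS.
rewrite -/(before r _ x) above_row //.
have lt_y : (if x + j < n then x + j else x + j - n) < n by case: ifP; lia.
exact: min (Ordinal lt_y).
Qed.

(** Modulo [n] the excess at [x] is [- m * x], and [m] is invertible. *)
Lemma excess_inj m n r s i j : coprime m n -> i < n -> j < n ->
  excess m n r s i = excess m n r s j -> i = j.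
Proof.
move=> co_mn; wlog le_ij : i j / i <= j => [IH | _ lt_j eq_h].
  move=> lt_i lt_j eq_h; case/orP: (leq_total i j) => le_ij; first exact: IH.
  exact/esym/IH.
have: n %| m * (j - i).
  have -> : m * (j - i) = n * (before r s j - before r s i).
    move: eq_h; rewrite /excess !mulnBr.
    have : m * i <= m * j by rewrite leq_mul2l le_ij orbT.
    have : m * j <= m * n by rewrite leq_mul2l (ltnW lt_j) orbT.
    by lia.
  exact: dvdn_mulr.
rewrite Gauss_dvdr 1?coprime_sym // => /dvdn_leq.
by case: (posnP (j - i)) => [|_ /(_ isT)]; lia.
Qed.

(** By [above_shift] a shift qualifies iff it starts at a minimum of the excess, and
    by [excess_inj] the minimum is attained only once. *)
Lemma cycle_lemma m n r s : 0 < n -> coprime m n -> s \in multisets (n * r) m ->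
  \sum_(j < n) above m n r (shift (n * r) ((n - j) * r) s) = 1.
Proof.
move=> n_gt0 co_mn s_in.
pose f (j : 'I_n) := excess m n r s j.
case: (arg_minnP (P := predT) f (i0 := Ordinal n_gt0) isT) => j _ min_j.
rewrite (bigD1 j) //= above_shift // (introT forallP) => [|y]; last exact: min_j.
rewrite big1 ?addn0 // => i ne_ij; rewrite above_shift //; apply/eqP; rewrite eqb0.
apply: contra ne_ij => /forallP/(_ j) le_ij; apply/eqP/val_inj.
apply: (excess_inj (m := m) (r := r) (s := s) co_mn); rewrite ?ltn_ord //.
by apply/eqP; rewrite eqn_leq le_ij; apply: min_j.
Qed.

(** Double counting of the pairs of a multiset and a shift that puts it above the
    diagonal: by [cycle_lemma] each multiset occurs once, and by [count_shift]
    each of the [n] shifts occurs as often as the trivial one. *)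
Lemma count_above m n r : 0 < n -> 0 < r -> coprime m n ->
  n * count (above m n r) (multisets (n * r) m) = 'C(n * r + m - 1, m).
Proof.
move=> n_gt0 r_gt0 co_mn; have N_gt0 : 0 < n * r by rewrite muln_gt0 n_gt0.
rewrite -size_multisets // -sum1_size.
rewrite -(eq_big_seq _ (fun s => @cycle_lemma m n r s n_gt0 co_mn)) exchange_big /=.
have -> c : n * c = \sum_(j < n) c by rewrite sum_nat_const card_ord.
apply: eq_bigr => j _.
rewrite -(@count_shift _ _ ((n - j) * r)) //; last by rewrite leq_mul2r leq_subr orbT.
by rewrite -sum1_count big_mkcond; apply: eq_bigr => s _; case: above.
Qed.

(** * Counting parking functions *)

Lemma card_parking_functions m n r : 0 < n -> 0 < r ->
  #|parking_functions m n r| = count (above m n r) (multisets (n * r) m).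
Proof.
move=> n_gt0 r_gt0; rewrite -size_filter cardE.
rewrite -(size_map (fun p => keys 0 (@word m n r p))); apply: perm_size.
have word_None p : count_mem None (@word m n r p) = n.
  rewrite -[word p]take_size size_word count_None_word.
  by have /and3P[/eqP] := valP (tag p).
have word_Some p : count isSome (@word m n r p) = m.
  rewrite -[word p]take_size size_word count_isSome_word.
  by have /and3P[_ /eqP] := valP (tag p).
apply: uniq_perm.
- rewrite map_inj_uniq ?enum_uniq // => p q /keys_inj eq_pq.
  by apply/word_inj/eq_pq; rewrite !word_None.
- exact/filter_uniq/multisets_uniq.
move=> s; apply/mapP/idP => [[p] | ].
  rewrite mem_enum inE semistandard_word => ss_p ->.
  have abv : above m n r (keys 0 (word p)).
    apply/(above_keys (word_None p) (word_Some p)) => k.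
    rewrite size_word count_isSome_word count_None_word -ltnS => lt_k.
    by have /and3P[_ _ /forallP/(_ (Ordinal lt_k))] := valP (tag p).
  rewrite mem_filter abv mem_multisets sorted_keys ss_p size_keys word_Some eqxx /=.
  (* At abscissa n the diagonal condition says that all m keys are below n * r. *)
  rewrite all_count eqn_leq count_size size_keys word_Some /=.
  by have := forallP abv ord_max; rewrite /= mulnC leq_pmul2l.
rewrite mem_filter mem_multisets => /and4P[abv s_sorted /eqP s_size s_lt].
have [|u cnt_u keys_u] := @keys_surj r 0 n s r_gt0 s_sorted.
  by rewrite add0n mul0n.
have size_u : count isSome u = m by rewrite -(size_keys 0) keys_u.
have [|p word_p] := word_surj r_gt0 cnt_u size_u; first by rewrite keys_u.
exists p; last by rewrite word_p.
by rewrite mem_enum inE semistandard_word -(sorted_keys 0) word_p keys_u.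
Qed.

Local Open Scope ring_scope.

Theorem theorem2p28 (m n r : nat) (m_ge1 : (1 <= m)%N) (n_ge1 : (1 <= n)%N)
    (r_ge1 : (1 <= r)%N) (coprime_mn : coprime m n) :
  #|parking_functions m n r|%:R = rational_catalan m n r.
Proof.
rewrite /rational_catalan -count_above // GRing.natrM GRing.mulKf.
  by rewrite card_parking_functions.
by rewrite Num.Theory.pnatr_eq0 -lt0n.
Qed.
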